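(* For every odd integer $N\ge 7$, the Hessian $D^2\Phi_N(X)$ is negative definite at every point $X\in\mathcal D_N$. Consequently $\Phi_N$ has at most one critical point in the convex domain $\mathcal D_N$.
   Context: Let $N$ be odd and let $X=(C,u_0,\ldots,u_{N-1})\in\mathbb R^{N+1}$, with indices of $u_i$ read modulo $N$. Domain: $\mathcal D_N\subset\mathbb R^{N+1}$ is the set of all $X$ such that for every $i\in\mathbb Z/N\mathbb Z$: $$u_i>0,\qquad 0<2(u_i+C)<1,\qquad |\sqrt{u_i}-\sqrt{u_{i+1}}|<1<\sqrt{u_i}+\sqrt{u_{i+1}}.$$ Triangle term: for $u,v>0$ such that $\sqrt u,\sqrt v,1$ are the side lengths of a nondegenerate triangle, let $$\Delta(u,v)=\tfrac14\sqrt{2uv+2u+2v-u^2-v^2-1}$$ be its area, and let $\alpha,\beta\in(0,\pi)$ be its angles at the two endpoints of the unit side, $\alpha$ being the angle between the unit side and the side of length $\sqrt u$, and $\beta$ the angle between the unit side and the side of length $\sqrt v$; thus $\cos\alpha=\frac{u+1-v}{2\sqrt u}$ and $\cos\beta=\frac{v+1-u}{2\sqrt v}$. Put $$E(u,v)=4\Delta(u,v)-2u\alpha-2v\beta .$$ Potential term: for $0<2(u+C)<1$ let $x=\arccos(2(u+C))\in(0,\pi/2)$ and $V_C(u)=x\cos x-\sin x$. Variational function: for $X\in\mathcal D_N$, $$\Phi_N(X)=\sum_{i=0}^{N-1}E(u_i,u_{i+1})+2V_C(u_0)+\sum_{i=1}^{N-1}V_C(u_i)-2\pi C .$$ The Hessian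 is taken with respect to all $N+1$ variables $(C,u_0,\ldots,u_{N-1})$. *)

(* Defs.v *)
From mathcomp Require Import all_boot all_order all_algebra.
From mathcomp Require Import all_classical all_reals all_analysis.
Set Implicit Arguments.
Unset Strict Implicit.
Unset Printing Implicit Defensive.
Import Order.TTheory GRing.Theory Num.Theory.
Import numFieldNormedType.Exports.
Local Open Scope classical_set_scope.
Local Open Scope ring_scope.

Section calculus.
Variables (R : realType) (n : nat).
Implicit Types (f : 'rV[R]_n.+1 -> R) (X : 'rV[R]_n.+1).

Definition partial f (i : 'I_n.+1) : 'rV[R]_n.+1 -> R :=
  'D_(delta_mx 0 i) f.

Definition hessian f X : 'M[R]_n.+1 :=
  \matrix_(i, j) partial (partial f j) i X.

(* ['D_v f] is total (a default value is returned where the limit does not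
   exist), so [hessian f X] is meaningful only under this condition. *)
Definition twice_differentiable f X : Prop :=
  (\forall Y \near X, differentiable f Y) /\
  (forall i, differentiable (partial f i) X).

Definition critical_point f X : Prop := is_diff X f (fun=> 0).

End calculus.

Definition negative_definite (R : realType) (n : nat) (A : 'M[R]_n) : Prop :=
  A \is symmetricmx /\
  forall v : 'rV[R]_n, v != 0 -> (v *m A *m v^T) 0 0 < 0.

Section triangle.
Variable R : realType.
Implicit Types u v : R.

(* Triangle with sides [sqrt u], [sqrt v] and 1: its area (Heron), and its
   angles at the endpoints of the unit side (law of cosines); [acos] takes its
   values in [0, pi]. *)
Definition triangle_area u v : R :=
  4^-1 * Num.sqrt (2 * u * v + 2 * u + 2 * v - u ^+ 2 - v ^+ 2 - 1).

Definition triangle_alpha u v : R := acos ((u + 1 - v) / (2 * Num.sqrt u)).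

Definition triangle_beta u v : R := acos ((v + 1 - u) / (2 * Num.sqrt v)).

Definition triangle_term u v : R :=
  4 * triangle_area u v - 2 * u * triangle_alpha u v
  - 2 * v * triangle_beta u v.

Definition potential_term (C u : R) : R :=
  let x := acos (2 * (u + C)) in x * cos x - sin x.

End triangle.

Section variational.
Variables (R : realType) (N : nat).
Implicit Type X : 'rV[R]_N.+1.

(* A point (C, u_0, ..., u_(N-1)) is a row vector: entry 0 is C and entry
   k + 1 is u_k. *)
Definition coordC X : R := X 0 ord0.

Definition coordu X (i : nat) : R := X 0 (inord (i %% N).+1).

Definition domain : set 'rV[R]_N.+1 := [set X | forall i : nat,
  [/\ 0 < coordu X i,
      0 < 2 * (coordu X i + coordC X) < 1,
      `|Num.sqrt (coordu X i) - Num.sqrt (coordu X i.+1)| < 1 &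
      1 < Num.sqrt (coordu X i) + Num.sqrt (coordu X i.+1)]].

Definition Phi X : R :=
  \sum_(0 <= i < N) triangle_term (coordu X i) (coordu X i.+1)
  + 2 * potential_term (coordC X) (coordu X 0)
  + \sum_(1 <= i < N) potential_term (coordC X) (coordu X i)
  - 2 * pi * coordC X.

End variational.

Arguments domain R N : clear implicits.
Arguments Phi R N X : clear implicits.

(* Main.v *)
Require Import Defs.
From HB Require Import structures.
From mathcomp Require Import all_boot all_order all_algebra.
From mathcomp Require Import all_classical all_reals all_analysis.
From mathcomp Require Import ring lra.
Set Implicit Arguments.
Unset Strict Implicit.
Unset Printing Implicit Defensive.
Import Order.TTheory GRing.Theory Num.Theory.
Import numFieldNormedType.Exports.
Local Open Scope classical_set_scope.
Local Open Scope ring_scope.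

(** The gradient of [Phi] is simple, because to first order a variation of the
angles does not change the triangle term: the partial derivatives of E(u, v) are
- 2 alpha and - 2 beta, and V_C'(u) = 2 arccos (2 (u + C)).  Put
S = [heron u v] = 16 Area^2 and s_i = sqrt (1 - (2 (u_i + C))^2).  The second
derivative of [Phi] in the direction (c, a_0, ..., a_(N-1)) is then the sum over
i of
  M_i(a_i, a_(i+1)) - 4 m_i (a_i + c)^2 / s_i,
where m_0 = 2, m_i = 1 for i > 0, and M_i is, for u = u_i and v = u_(i+1),
  M(x, y) = ((u + v - 1) (x^2 / u + y^2 / v) - 4 x y) / sqrt S.

Half of each potential contribution is given to each of the two edges at the
vertex i, and every edge is then negative by itself ([edge_negative]).  Write
d = u - v and W = u + v - d^2.  The matrix of M has determinant - 1 / (u v) and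
M(1, 1) = - W / (u v sqrt S) < 0, so maximising M over translations along
(1, 1) gives M(x, y) <= sqrt S / W * (x - y)^2 ([edge_quadratic_form_le]).
This bound no longer sees c, since x - y = (x + c) - (y + c), and the
Cauchy-Schwarz inequality gives
  (x - y)^2 <= (s + t) ((x + c)^2 / s + (y + c)^2 / t).
What remains is sqrt S (s + t) < 2 W.  It holds because S = 2 W + d^2 - 1, so
that W^2 - S (1 - d^2) = (W - (1 - d^2))^2 >= 0, and because the common
constant C ties s and t to d: with p = 2 (u + C) and q = 2 (v + C),
  (s + t)^2 <= 4 - 2 p^2 - 2 q^2 < 4 - (p - q)^2 = 4 (1 - d^2).

The triangle inequalities say that S > 0 ([triangle_ineqP]); S is a concave
function of (u, v), so the domain is convex, and it is open.  Two critical
points would contradict the mean value theorem for the derivative of [Phi] along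
the segment that joins them ([critical_point_unique]). *)

(** * One edge *)

(** Sixteen times the squared area of the triangle with sides [sqrt u],
[sqrt v] and 1 (Heron's formula). *)
Definition heron {R : realType} (u v : R) : R :=
  2 * u * v + 2 * u + 2 * v - u ^+ 2 - v ^+ 2 - 1.

Lemma heronC (R : realType) (u v : R) : heron u v = heron v u.
Proof. by rewrite /heron; ring. Qed.

(** Heron's expression factors as
(([sqrt u] + [sqrt v])^2 - 1) (1 - ([sqrt u] - [sqrt v])^2), and its two factors
cannot both be negative. *)
Lemma triangle_ineqP (R : realType) (u v : R) : 0 < u -> 0 < v ->
  (`|Num.sqrt u - Num.sqrt v| < 1 /\ 1 < Num.sqrt u + Num.sqrt v) <->
  0 < heron u v.
Proof.
move=> u0 v0; set p := Num.sqrt u; set q := Num.sqrt v.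
have p0 : 0 < p by rewrite sqrtr_gt0.
have q0 : 0 < q by rewrite sqrtr_gt0.
have -> : heron u v = ((p + q) ^+ 2 - 1) * (1 - (p - q) ^+ 2).
  by rewrite /heron -(sqr_sqrtr (ltW u0)) -(sqr_sqrtr (ltW v0)) -/p -/q; ring.
have gap : (p - q) ^+ 2 < (p + q) ^+ 2 by nra.
rewrite ltr_norml; split.
  by move=> [/andP[h1 h2] h3]; apply: mulr_gt0; nra.
move=> S0.
have lt1 : (p - q) ^+ 2 < 1 by nra.
have gt1 : 1 < (p + q) ^+ 2 by nra.
by split; [apply/andP; split; nra | nra].
Qed.

(** Up to sign, the quadratic part of [heron] is the square of u - v; the gap in
Jensen's inequality is l (1 - l) times the squared difference of the values of
u - v. *)
Lemma heron_concave (R : realType) (l u v u' v' : R) : 0 <= l <= 1 ->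
  l * heron u v + (1 - l) * heron u' v' <=
  heron (l * u + (1 - l) * u') (l * v + (1 - l) * v').
Proof.
move=> /andP[l0 l1]; rewrite -subr_ge0.
rewrite [leRHS](_ : _ = l * (1 - l) * (u - v - (u' - v')) ^+ 2); last first.
  by rewrite /heron; ring.
by rewrite mulr_ge0 ?sqr_ge0// mulr_ge0// subr_ge0.
Qed.

(** The right-hand side is the maximum of the left-hand side over simultaneous
translations of x and y; the difference of the two sides is a multiple of
L^2, where L = 0 singles out the maximiser. *)
Lemma edge_quadratic_form_le (R : realType) (u v x y : R) :
  0 < u -> 0 < v -> 0 < u + v - (u - v) ^+ 2 ->
  (u + v - 1) * (x ^+ 2 / u + y ^+ 2 / v) - 4 * x * y <=
  heron u v / (u + v - (u - v) ^+ 2) * (x - y) ^+ 2.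
Proof.
move=> u0 v0 W0.
pose L := (u + v - 1) * (x / u + y / v) - 2 * (x + y).
rewrite -subr_ge0.
have -> : heron u v / (u + v - (u - v) ^+ 2) * (x - y) ^+ 2 -
   ((u + v - 1) * (x ^+ 2 / u + y ^+ 2 / v) - 4 * x * y) =
   u * v / (u + v - (u - v) ^+ 2) * L ^+ 2.
  by rewrite /heron /L; field; rewrite !gt_eqF.
by rewrite mulr_ge0 ?sqr_ge0// divr_ge0 ?ltW// mulr_gt0.
Qed.

Definition edge_hessian {R : realType} (u v x y : R) : R :=
  ((u + v - 1) * (x ^+ 2 / u + y ^+ 2 / v) - 4 * x * y) /
  Num.sqrt (heron u v).

(** The polar form of [edge_hessian], which gives the mixed second derivatives of
the triangle term. *)
Definition edge_polar {R : realType} (u v x y x' y' : R) : R :=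
  ((u + v - 1) * (x * x' / u + y * y' / v) - 2 * (x * y' + y * x')) /
  Num.sqrt (heron u v).

Lemma edge_polar_diag (R : realType) (u v x y : R) :
  edge_polar u v x y x y = edge_hessian u v x y.
Proof. by rewrite /edge_polar /edge_hessian; congr (_ / _); ring. Qed.

Lemma edge_polarC (R : realType) (u v x y x' y' : R) :
  edge_polar u v x y x' y' = edge_polar u v x' y' x y.
Proof. by rewrite /edge_polar; congr (_ / _); ring. Qed.

Lemma edge_hessian_diag_lt0 (R : realType) (u v c : R) :
  0 < u -> 0 < v -> 0 < heron u v -> 0 < u + v - (u - v) ^+ 2 -> c != 0 ->
  edge_hessian u v c c < 0.
Proof.
move=> u0 v0 S0 W0 c0; rewrite /edge_hessian.
rewrite pmulr_llt0 ?invr_gt0 ?sqrtr_gt0//.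
have -> : (u + v - 1) * (c ^+ 2 / u + c ^+ 2 / v) - 4 * c * c =
    - (c ^+ 2 * (u + v - (u - v) ^+ 2) / (u * v)).
  by field; rewrite !gt_eqF.
have c2 : 0 < c ^+ 2 by rewrite exprn_even_gt0.
by rewrite oppr_lt0 divr_gt0// mulr_gt0.
Qed.

(** Positivity of [heron u v] means 2 (u + v) > 1 + (u - v)^2, and
1 + z > 2 z for z < 1. *)
Lemma edge_spread_gt0 (R : realType) (u v : R) : (u - v) ^+ 2 < 1 ->
  0 < heron u v -> 0 < u + v - (u - v) ^+ 2.
Proof. by rewrite /heron; nra. Qed.

Lemma cauchy_weighted (R : realType) (s t b b' : R) : 0 < s -> 0 < t ->
  (b - b') ^+ 2 <= (s + t) * (b ^+ 2 / s + b' ^+ 2 / t).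
Proof.
move=> s0 t0; rewrite -subr_ge0.
have -> : (s + t) * (b ^+ 2 / s + b' ^+ 2 / t) - (b - b') ^+ 2 =
    (t * b + s * b') ^+ 2 / (s * t) by field; rewrite !gt_eqF.
by rewrite divr_ge0 ?sqr_ge0// mulr_ge0 ?ltW.
Qed.

(** The balance on one edge.  The numbers p = 2 (u + C) and q = 2 (v + C) share
the constant C; without this link between u - v and p - q, the edge form could
exceed any multiple of x^2 + y^2, as it does for a small u and v close to 1. *)
Lemma edge_negative (R : realType) (u v p q c x y : R) :
  0 < u -> 0 < v -> 0 < heron u v ->
  0 < p < 1 -> 0 < q < 1 -> u - v = (p - q) / 2 ->
  [|| c != 0, x != 0 | y != 0] ->
  edge_hessian u v x y <
    2 * ((x + c) ^+ 2 / Num.sqrt (1 - p ^+ 2)) +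
    2 * ((y + c) ^+ 2 / Num.sqrt (1 - q ^+ 2)).
Proof.
move=> u0 v0 S0 /andP[p0 p1] /andP[q0 q1] pq nz.
set s := Num.sqrt (1 - p ^+ 2); set t := Num.sqrt (1 - q ^+ 2).
have s2 : s ^+ 2 = 1 - p ^+ 2 by rewrite sqr_sqrtr//; nra.
have t2 : t ^+ 2 = 1 - q ^+ 2 by rewrite sqr_sqrtr//; nra.
have s0 : 0 < s by rewrite sqrtr_gt0; nra.
have t0 : 0 < t by rewrite sqrtr_gt0; nra.
have d1 : (u - v) ^+ 2 < 1 by rewrite pq; nra.
have W0 := edge_spread_gt0 d1 S0.
have r0 : 0 < Num.sqrt (heron u v) by rewrite sqrtr_gt0.
have r2 : Num.sqrt (heron u v) ^+ 2 = heron u v by rewrite sqr_sqrtr// ltW.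
set W := u + v - (u - v) ^+ 2 in W0.
set r := Num.sqrt (heron u v) in r0 r2.
(* If both shifted coordinates vanish, the bound through x - y is not strict,
   and the direction is (- c, - c), where M itself is negative. *)
have [/andP[/eqP xc /eqP yc]|bn0] := boolP ((x + c == 0) && (y + c == 0)).
  rewrite xc yc expr0n/= !mul0r mulr0 addr0.
  have xE : x = - c by lra.
  have yE : y = - c by lra.
  rewrite xE yE; apply: edge_hessian_diag_lt0 => //.
  by move: nz; rewrite xE yE oppr_eq0; case: (c == 0).
pose K := (x + c) ^+ 2 / s + (y + c) ^+ 2 / t.
have K0 : 0 < K.
  have a1 : 0 <= (x + c) ^+ 2 / s by rewrite divr_ge0 ?sqr_ge0// ltW.
  have a2 : 0 <= (y + c) ^+ 2 / t by rewrite divr_ge0 ?sqr_ge0// ltW.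
  move: bn0; rewrite negb_and => /orP[] b0.
    by apply: ltr_pwDl => //; rewrite divr_gt0// exprn_even_gt0.
  by apply: ltr_wpDl => //; rewrite divr_gt0// exprn_even_gt0.
rewrite [ltRHS](_ : _ = 2 * K); last by rewrite /K; ring.
have cs : (x - y) ^+ 2 <= (s + t) * K.
  by rewrite (_ : x - y = (x + c) - (y + c)); [exact: cauchy_weighted | ring].
have edge_le : edge_hessian u v x y <= r / W * (x - y) ^+ 2.
  rewrite /edge_hessian ler_pdivrMr// -/r.
  apply: le_trans (edge_quadratic_form_le _ _ u0 v0 W0) _.
  rewrite -/W -r2 le_eqVlt; apply/orP; left; apply/eqP.
  by field; rewrite gt_eqF.
(* 1 / sqrt (1 - d^2) is the maximum of sqrt S / W at fixed d. *)
have WS : heron u v * (1 - (u - v) ^+ 2) <= W ^+ 2.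
  rewrite -subr_ge0 [leRHS](_ : _ = (W - (1 - (u - v) ^+ 2)) ^+ 2) ?sqr_ge0//.
  by rewrite /heron /W; ring.
have st : (s + t) ^+ 2 < 4 * (1 - (u - v) ^+ 2).
  have : (s + t) ^+ 2 <= 2 * (s ^+ 2 + t ^+ 2).
    by have := sqr_ge0 (s - t); rewrite sqrrB sqrrD; lra.
  rewrite s2 t2 pq; nra.
have rst : r * (s + t) < 2 * W.
  have lhs0 : 0 <= r * (s + t) by rewrite mulr_ge0 ?addr_ge0 ?ltW.
  have rhs0 : 0 <= 2 * W by rewrite mulr_ge0 ?ltW.
  rewrite -(@ltr_pXn2r _ 2)// ?nnegrE//.
  rewrite !exprMn r2.
  have : heron u v * (s + t) ^+ 2 < heron u v * (4 * (1 - (u - v) ^+ 2)).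
    by rewrite ltr_pM2l.
  by move: WS; lra.
apply: le_lt_trans edge_le _.
apply: (@le_lt_trans _ _ (r / W * ((s + t) * K))).
  by rewrite ler_pM2l// divr_gt0.
rewrite mulrA ltr_pM2r// mulrAC ltr_pdivrMr//.
Qed.

(** * Differentials of the terms *)

(** Differentials are local; this moves a differential from a closed formula,
valid only near a point, to the function itself. *)
Lemma near_eq_is_diff (R : realType) (V W : normedModType R) (f g df : V -> W)
    (x : V) :
  (\forall y \near x, f y = g y) -> is_diff x f df -> is_diff x g df.
Proof.
move=> fg dfx.
have /diff_locallyP[dfc dfo] := @ex_diff _ _ _ _ _ _ _ dfx.
have gx : g x = f x by rewrite (nbhs_singleton fg).
have go : g \o shift x = cst (g x) + 'd f x +o_ 0 id.
  apply/eqaddoP => e e0.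
  have /eqaddoP/(_ e e0) fo := dfo.
  have fg0 : \forall h \near (0 : V), f (h + x) = g (h + x).
    by move: fg; rewrite (near_shift 0 x) /= subr0.
  near=> h.
  have -> : (g \o shift x - (cst (g x) + 'd f x)) h =
            (f \o shift x - (cst (f x) + 'd f x)) h.
    rewrite !fctE /= gx.
    by congr (_ - _); apply/esym; near: h.
  by near: h.
have dg : 'd g x = 'd f x :> (V -> W) by exact: diff_unique.
split; first by apply/diff_locallyP; rewrite dg.
by rewrite dg diff_val.
Unshelve. all: by end_near. Qed.

Lemma is_diff_derive (R : realType) (V W : normedModType R) (f df : V -> W)
    (x v : V) : is_diff x f df -> 'D_v f x = df v.
Proof. by move=> dfx; rewrite deriveE ?diff_val. Qed.

Lemma is_diff_chain (R : realType) (V : normedModType R) (f df : V -> R)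
    (g : R -> R) (dg : R) (x : V) :
  is_diff x f df -> is_derive (f x) 1 g dg ->
  is_diff x (fun y => g (f y)) (fun h => dg * df h).
Proof.
move=> dfx [gx <-].
have dgx : is_diff (f x) g (fun h => h *: 'D_1 g (f x)).
  split; first exact/derivable1_diffP.
  by rewrite deriv1E// derive1E.
apply: is_diff_eq (is_diff_comp dfx dgx) _.
by apply/funext => h /=; rewrite mulrC.
Qed.

Lemma is_diff_sumr (R : realType) (V W : normedModType R) (I : Type)
    (r : seq I) (F dF : I -> V -> W) (x : V) :
  (forall i, is_diff x (F i) (dF i)) ->
  is_diff x (fun y => \sum_(i <- r) F i y) (fun h => \sum_(i <- r) dF i h).
Proof.
move=> dFx.
have -> : (fun y => \sum_(i <- r) F i y) = \sum_(i <- r) F i.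
  by apply/funext => y; rewrite fct_sumE.
have -> : (fun y => \sum_(i <- r) dF i y) = \sum_(i <- r) dF i.
  by apply/funext => y; rewrite fct_sumE.
elim: r => [|i r IH]; first by rewrite !big_nil; exact: is_diff_cst.
by rewrite !big_cons; exact: is_diffD.
Qed.

(** The next rules restate those for ring operations on functions with explicit
[fun], the form in which the terms of [Phi] are written. *)
Section pointwise.
Variables (R : realType) (V : normedModType R).
Implicit Types (f g df dg : V -> R) (x : V).

Lemma is_diff_add f g df dg x : is_diff x f df -> is_diff x g dg ->
  is_diff x (fun y => f y + g y) (fun h => df h + dg h).
Proof. by move=> dfx dgx; exact: (is_diffD dfx dgx). Qed.

Lemma is_diff_sub f g df dg x : is_diff x f df -> is_diff x g dg ->
  is_diff x (fun y => f y - g y) (fun h => df h - dg h).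
Proof. by move=> dfx dgx; exact: (is_diffB dfx dgx). Qed.

Lemma is_diff_mul f g df dg x : is_diff x f df -> is_diff x g dg ->
  is_diff x (fun y => f y * g y) (fun h => f x * dg h + g x * df h).
Proof. by move=> dfx dgx; exact: (is_diffM dfx dgx). Qed.

Lemma is_diff_const (k : R) x : is_diff x (fun=> k) (fun=> 0).
Proof. exact: (is_diff_cst k x). Qed.

Lemma is_diff_scale (k : R) f df x : is_diff x f df ->
  is_diff x (fun y => k * f y) (fun h => k * df h).
Proof. by move=> dfx; exact: (is_diffZ k dfx). Qed.

Lemma is_diff_inv f df x : is_diff x f df -> f x != 0 ->
  is_diff x (fun y => (f y)^-1) (fun h => - (f x) ^- 2 * df h).
Proof.
move=> dfx fx0; apply: is_diff_eq (is_diff_comp dfx _) _.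
  exact: differentiableP (differentiable_Rinv fx0).
by apply/funext => h /=; rewrite diff_Rinv.
Qed.

End pointwise.

Section terms.
Variables (R : realType) (V : normedModType R).
Implicit Types (U W dU dW : V -> R) (x : V).

(** Since sin alpha = sqrt S / (2 sqrt u), the factor sqrt u cancels and the
derivatives of the angle are rational in u, v and sqrt S. *)
Lemma is_diff_triangle_alpha U W dU dW x :
  is_diff x U dU -> is_diff x W dW -> 0 < U x -> 0 < heron (U x) (W x) ->
  is_diff x (fun y => triangle_alpha (U y) (W y))
    (fun h => (dW h - (U x + W x - 1) / (2 * U x) * dU h) /
              Num.sqrt (heron (U x) (W x))).
Proof.
move=> dUx dWx; set u := U x; set w := W x => u0 S0.
set q := Num.sqrt u; set r := Num.sqrt (heron u w).
have q0 : 0 < q by rewrite sqrtr_gt0.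
have r0 : 0 < r by rewrite sqrtr_gt0.
have uE : u = q ^+ 2 by rewrite sqr_sqrtr// ltW.
pose z := (u + 1 - w) / (2 * q).
(* This is sin alpha, where z = cos alpha. *)
have zE : Num.sqrt (1 - z ^+ 2) = r / (2 * q).
  have -> : 1 - z ^+ 2 = (r / (2 * q)) ^+ 2.
    rewrite (expr_div_n r) sqr_sqrtr ?ltW// /z /heron uE.
    by field; rewrite gt_eqF.
  by rewrite sqrtr_sqr ger0_norm// divr_ge0 ?mulr_ge0 ?ltW.
have z1 : -1 < z < 1.
  have : 0 < Num.sqrt (1 - z ^+ 2) by rewrite zE divr_gt0 ?mulr_gt0.
  by rewrite sqrtr_gt0 => ?; apply/andP; split; nra.
have dq : is_diff x (fun y => Num.sqrt (U y)) (fun h => (2 * q)^-1 * dU h).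
  exact: is_diff_chain dUx (is_derive1_sqrt u0).
have q2 : 2 * q != 0 by rewrite mulf_neq0 ?gt_eqF.
have dqV := is_diff_inv (is_diff_scale 2 dq) q2.
have dz := is_diff_mul
  (is_diff_sub (is_diff_add dUx (is_diff_const 1 x)) dWx) dqV.
rewrite /triangle_alpha.
apply: (is_diff_eq (is_diff_chain dz (is_derive1_acos z1))).
apply/funext => h.
rewrite -/u -/w -/q -/z zE.
clear -q0 r0 uE; clearbody q r; rewrite uE.
by field; rewrite !gt_eqF.
Qed.

Lemma is_diff_heron U W dU dW x : is_diff x U dU -> is_diff x W dW ->
  is_diff x (fun y => heron (U y) (W y))
    (fun h => 2 * (W x + 1 - U x) * dU h + 2 * (U x + 1 - W x) * dW h).
Proof.
move=> dUx dWx.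
have dUU := is_diff_mul dUx dUx; have dWW := is_diff_mul dWx dWx.
have dUW := is_diff_mul dUx dWx.
have -> : (fun y => heron (U y) (W y)) =
   (fun y => 2 * (U y * W y) + 2 * U y + 2 * W y - U y * U y - W y * W y - 1).
  by apply/funext => y; rewrite /heron; ring.
apply: is_diff_eq (is_diff_sub (is_diff_sub (is_diff_sub (is_diff_add
  (is_diff_add (is_diff_scale 2 dUW) (is_diff_scale 2 dUx))
  (is_diff_scale 2 dWx)) dUU) dWW) (is_diff_const 1 x)) _.
by apply/funext => h; ring.
Qed.

(** The derivatives of the area and of the two angles cancel, as in the formula
of Schlaefli: the differential is the one obtained with the angles held
constant.  The symmetry [triangle_beta u v] = [triangle_alpha v u] yields the
derivatives of beta. *)
Lemma is_diff_triangle_term U W dU dW x :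
  is_diff x U dU -> is_diff x W dW -> 0 < U x -> 0 < W x ->
  0 < heron (U x) (W x) ->
  is_diff x (fun y => triangle_term (U y) (W y))
    (fun h => - 2 * triangle_alpha (U x) (W x) * dU h
              - 2 * triangle_beta (U x) (W x) * dW h).
Proof.
move=> dUx dWx u0 w0 S0.
have dS := is_diff_heron dUx dWx.
have r0 : 0 < Num.sqrt (heron (U x) (W x)) by rewrite sqrtr_gt0.
have dr := is_diff_chain dS (is_derive1_sqrt S0).
have da := is_diff_triangle_alpha dUx dWx u0 S0.
have db : is_diff x (fun y => triangle_beta (U y) (W y))
    (fun h => (dU h - (W x + U x - 1) / (2 * W x) * dW h) /
              Num.sqrt (heron (U x) (W x))).
  rewrite heronC; rewrite heronC in S0.
  exact: is_diff_triangle_alpha dWx dUx w0 S0.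
have -> : (fun y => triangle_term (U y) (W y)) =
   (fun y => Num.sqrt (heron (U y) (W y)) -
      2 * (U y * triangle_alpha (U y) (W y))
     - 2 * (W y * triangle_beta (U y) (W y))).
  apply/funext => y; rewrite /triangle_term /triangle_area -/(heron _ _).
  by field.
apply: (is_diff_eq (is_diff_sub (is_diff_sub dr
  (is_diff_scale 2 (is_diff_mul dUx da)))
  (is_diff_scale 2 (is_diff_mul dWx db)))).
by apply/funext => h; field; rewrite !gt_eqF.
Qed.

Lemma is_diff_acos_double U dU x : is_diff x U dU -> 0 < 2 * U x < 1 ->
  is_diff x (fun y => acos (2 * U y))
    (fun h => - 2 * dU h / Num.sqrt (1 - (2 * U x) ^+ 2)).
Proof.
move=> dUx /andP[p0 p1].
have p11 : -1 < 2 * U x < 1 by apply/andP; split; lra.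
apply: (is_diff_eq (is_diff_chain (is_diff_scale 2 dUx) (is_derive1_acos p11))).
by apply/funext => h; ring.
Qed.

(** As d(x cos x - sin x) = - x sin x dx and d(cos x) = - sin x dx, the
derivative of the potential with respect to cos x = 2 (U + W) is x. *)
Lemma is_diff_potential_term U W dU dW x :
  is_diff x W dW -> is_diff x U dU -> 0 < 2 * (U x + W x) < 1 ->
  is_diff x (fun y => potential_term (W y) (U y))
    (fun h => 2 * acos (2 * (U x + W x)) * (dU h + dW h)).
Proof.
move=> dWx dUx p01.
have da := is_diff_acos_double (is_diff_add dUx dWx) p01.
have dc := is_diff_chain da (is_derive_cos _).
have ds := is_diff_chain da (is_derive_sin _).
rewrite /potential_term /=.
apply: (is_diff_eq (is_diff_sub (is_diff_mul da dc) ds)).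
apply/funext => h.
have p1 : -1 <= 2 * (U x + W x) <= 1 by lra.
have s0 : 0 < Num.sqrt (1 - (2 * (U x + W x)) ^+ 2).
  by rewrite sqrtr_gt0; case/andP: p01 => ? ?; nra.
rewrite sin_acos//.
by field; rewrite gt_eqF.
Qed.

End terms.

(** * Second derivatives and critical points *)

Section second_order.
Variables (R : realType) (n : nat).
Implicit Types (f : 'rV[R]_n.+1 -> R) (X v : 'rV[R]_n.+1).

Lemma derive_partial f X v : differentiable f X ->
  'D_v f X = \sum_j v 0 j * partial f j X.
Proof.
move=> dfX; rewrite deriveE// {1}(row_sum_delta v) linear_sum.
by apply: eq_bigr => j _; rewrite linearZ /= /partial deriveE.
Qed.

(** Turns the matrix form of the second derivative into an iterated directional
derivative, so that the quadratic form can be computed without expanding it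
over coordinates. *)
Lemma is_diff_derive_hessian f X v : twice_differentiable f X ->
  is_diff X ('D_v f)
    (fun w => (w *m hessian f X *m v^T) 0 0).
Proof.
move=> [df ddf].
apply: (@near_eq_is_diff _ _ _ (fun Y => \sum_j v 0 j * partial f j Y)).
  by apply: filterS df => Y dfY; rewrite derive_partial.
apply: is_diff_eq (is_diff_sumr _ _) _.
  by move=> j; apply: is_diff_scale; exact: differentiableP (ddf j).
apply/funext => w; rewrite mxE; apply: eq_bigr => j _.
rewrite -deriveE// derive_partial// !mxE mulrC; congr (_ * _).
by apply: eq_bigr => i _; rewrite mxE.
Qed.

(** It suffices to know the differential [G] in closed form near the point, and
the differential [B] of [G] at the point. *)
Lemma hessian_near f X (G : 'rV[R]_n.+1 -> 'rV[R]_n.+1 -> R)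
    (B : 'rV[R]_n.+1 -> 'rV[R]_n.+1 -> R) :
  (\forall Y \near X, is_diff Y f (G Y)) ->
  (forall v, is_diff X (G^~ v) (B v)) ->
  twice_differentiable f X /\
  hessian f X = \matrix_(i, j) B (delta_mx 0 j) (delta_mx 0 i).
Proof.
move=> dG dB.
have dp i : is_diff X (partial f i) (B (delta_mx 0 i)).
  apply: near_eq_is_diff (dB (delta_mx 0 i)).
  by apply: filterS dG => Y dfY; rewrite /partial (is_diff_derive _ dfY).
split.
  by split => [|i]; [apply: filterS dG => Y dfY | have := dp i].
by apply/matrixP => i j; rewrite !mxE /partial (is_diff_derive _ (dp j)).
Qed.

(** The derivative of [f] along the segment from X to Y would vanish at both
ends, while its own derivative, the value of the Hessian form on Y - X, is
negative. *)
Lemma critical_point_unique f (D : set 'rV[R]_n.+1) X Y :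
  (forall Z, D Z -> twice_differentiable f Z /\
     forall v, v != 0 -> (v *m hessian f Z *m v^T) 0 0 < 0) ->
  (forall t : R, 0 <= t <= 1 -> D (X + t *: (Y - X))) ->
  critical_point f X -> critical_point f Y -> X = Y.
Proof.
move=> negD segD cX cY; apply/eqP/negP => /negP XY.
pose v := Y - X.
have v0 : v != 0 by rewrite subr_eq0 eq_sym.
pose L (t : R) := X + t *: v.
pose phi (t : R) := 'D_v f (L t).
have dL t : is_diff t L (fun h => h *: v).
  apply: is_diff_eq (is_diffD (is_diff_cst _ _) (is_diff_scalel _ _)) _.
  by apply/funext => h; rewrite !fctE add0r.
have dphi (t : R) : 0 <= t <= 1 ->
    is_derive t 1 phi ((v *m hessian f (L t) *m v^T) 0 0).
  move=> t01; have [tw _] := negD _ (segD t t01).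
  have d := is_diff_comp (dL t) (is_diff_derive_hessian v tw).
  have ddphi : differentiable phi t by [].
  split; first exact: diff_derivable.
  by rewrite (is_diff_derive _ d) /= scale1r.
have cphi : {within `[0, 1], continuous phi}.
  apply: derivable_within_continuous => t; rewrite in_itv /= => t01.
  by have [] := dphi _ t01.
have dphi_oo (t : R) : t \in `]0, 1[%R ->
    is_derive t 1 phi ((v *m hessian f (L t) *m v^T) 0 0).
  by rewrite in_itv /= => /andP[t0 t1]; apply: dphi; rewrite !ltW.
have [t] := MVT ltr01 dphi_oo cphi.
rewrite in_itv /= => /andP[t0 t1].
have t01 : 0 <= t <= 1 by rewrite !ltW.
have [_ /(_ v v0)] := negD _ (segD t t01).
have L0 : L 0 = X by rewrite /L scale0r addr0.
have L1 : L 1 = Y by rewrite /L scale1r addrC subrK.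
rewrite /phi L0 L1.
rewrite (is_diff_derive _ cX) (is_diff_derive _ cY) !subr0 mulr1.
by move=> + E; rewrite -E ltxx.
Qed.

End second_order.

(** * The function Phi *)

Section closed_polygon.
Variables (R : realType) (N : nat).
Implicit Types (X h k : 'rV[R]_N.+1).

Definition vertex_weight (i : nat) : R := if i == 0%N then 2 else 1.

Lemma vertex_weight_ge1 i : 1 <= vertex_weight i.
Proof. by rewrite /vertex_weight; case: ifP => // _; rewrite ler1n. Qed.

Lemma PhiE X : (0 < N)%N -> Phi R N X =
  \sum_(0 <= i < N) (triangle_term (coordu X i) (coordu X i.+1) +
     vertex_weight i * potential_term (coordC X) (coordu X i))
  - 2 * pi * coordC X.
Proof.
move=> N0; rewrite /Phi [in RHS]big_split /=.
congr (_ - _); rewrite -addrA; congr (_ + _).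
rewrite [RHS]big_ltn// /vertex_weight eqxx; congr (_ + _).
by rewrite big_nat [RHS]big_nat; apply: eq_bigr => -[|i]// _; rewrite mul1r.
Qed.

Lemma is_diff_entry n (X : 'rV[R]_n) j :
  is_diff X (fun Y => Y 0 j) (fun Y => Y 0 j).
Proof.
have lin : linear (fun Y : 'rV[R]_n => Y 0 j : R).
  by move=> a Y Z; rewrite !mxE.
pose linM := GRing.isLinear.Build _ _ _ _ _ lin.
pose f : {linear 'rV[R]_n -> R} := HB.pack (fun Y : 'rV[R]_n => Y 0 j : R) linM.
split; first exact: differentiable_coord.
by apply: (@diff_lin _ _ _ f); exact: coord_continuous.
Qed.

Lemma is_diff_coordC X : is_diff X (@coordC R N) (@coordC R N).
Proof. exact: is_diff_entry. Qed.

Lemma is_diff_coordu X i : is_diff X ((@coordu R N)^~ i) ((@coordu R N)^~ i).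
Proof. exact: is_diff_entry. Qed.

(** The form of the domain used for openness and convexity: each condition is a
strict lower bound on a concave polynomial. *)
Lemma domainP X : domain R N X <-> forall i, [/\ 0 < coordu X i,
   0 < 2 * (coordu X i + coordC X) < 1 &
   0 < heron (coordu X i) (coordu X i.+1)].
Proof.
split=> dX i; have [u0 p01] := dX i; have [v0 _] := dX i.+1.
  by move=> _ _ h1 h2; split => //; apply/triangle_ineqP.
by move=> _ /(triangle_ineqP u0 v0)[].
Qed.

Lemma coordu_mod X i : coordu X (i %% N) = coordu X i.
Proof. by rewrite /coordu modn_mod. Qed.

(** Periodicity reduces the conditions to the finitely many indices i < N, so
they persist simultaneously near a point. *)
Lemma domain_near X : (0 < N)%N -> domain R N X ->
  \forall Y \near X, domain R N Y.
Proof.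
move=> N0 /domainP dX.
have pos (F : 'rV[R]_N.+1 -> R) dF : is_diff X F dF -> 0 < F X ->
    \forall Y \near X, 0 < F Y.
  move=> dFX FX0.
  have cF : F @ X --> F X by exact: differentiable_continuous.
  exact: cvgr_gt cF _ FX0.
have nearX (i : 'I_N) : \forall Y \near X, [/\ 0 < coordu Y i,
    0 < 2 * (coordu Y i + coordC Y) < 1 &
    0 < heron (coordu Y i) (coordu Y i.+1)].
  have [u0 /andP[p0 p1] S0] := dX i.
  have du := is_diff_coordu X i; have dv := is_diff_coordu X i.+1.
  have dp := is_diff_scale 2 (is_diff_add du (is_diff_coordC X)).
  have dq := is_diff_sub (is_diff_const 1 X) dp.
  have q0 : 0 < 1 - 2 * (coordu X i + coordC X) by rewrite subr_gt0.
  near=> Y; split.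
  - by near: Y; exact: pos du u0.
  - apply/andP; split; first by near: Y; exact: pos dp p0.
    by rewrite -subr_gt0; near: Y; exact: pos dq q0.
  - by near: Y; exact: pos (is_diff_heron du dv) S0.
apply: filterS (filter_forall _ nearX) => Y dY; apply/domainP => i.
have /= := dY (Ordinal (ltn_pmod i N0)).
rewrite coordu_mod -(coordu_mod Y (i %% N).+1) -(addn1 (i %% N)) modnDml.
by rewrite addn1 coordu_mod.
Unshelve. all: by end_near. Qed.

Lemma convex_comb_gt0 (l a b : R) : 0 <= l <= 1 -> 0 < a -> 0 < b ->
  0 < l * a + (1 - l) * b.
Proof. by move=> /andP[l0 l1] a0 b0; nra. Qed.

Lemma domain_segment X Y (l : R) : 0 <= l <= 1 ->
  domain R N X -> domain R N Y -> domain R N (l *: X + (1 - l) *: Y).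
Proof.
move=> l01 /domainP dX /domainP dY; apply/domainP => i.
have uE j : coordu (l *: X + (1 - l) *: Y) j =
    l * coordu X j + (1 - l) * coordu Y j by rewrite /coordu !mxE.
have cE : coordC (l *: X + (1 - l) *: Y) =
    l * coordC X + (1 - l) * coordC Y by rewrite /coordC !mxE.
have [uX /andP[pX qX] SX] := dX i; have [uY /andP[pY qY] SY] := dY i.
rewrite !uE cE; split; first exact: convex_comb_gt0.
  have q0 : 0 < 1 - 2 * (coordu X i + coordC X) by rewrite subr_gt0.
  have q0' : 0 < 1 - 2 * (coordu Y i + coordC Y) by rewrite subr_gt0.
  have := convex_comb_gt0 l01 pX pY; have := convex_comb_gt0 l01 q0 q0'.
  by move=> ? ?; apply/andP; split; lra.
by apply: lt_le_trans (heron_concave _ _ _ _ l01); exact: convex_comb_gt0.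
Qed.

Lemma domain_convex : convex_set (domain R N).
Proof.
move=> X Y l; rewrite !inE => dX dY.
by apply: (@domain_segment X Y l%:num) => //; apply/andP.
Qed.

Definition gradPhi X h : R :=
  \sum_(0 <= i < N)
    (- 2 * triangle_alpha (coordu X i) (coordu X i.+1) * coordu h i
     - 2 * triangle_beta (coordu X i) (coordu X i.+1) * coordu h i.+1
     + vertex_weight i * (2 * acos (2 * (coordu X i + coordC X)) *
                   (coordu h i + coordC h)))
  - 2 * pi * coordC h.

Definition hessPhi X h k : R :=
  \sum_(0 <= i < N)
    (edge_polar (coordu X i) (coordu X i.+1)
        (coordu h i) (coordu h i.+1) (coordu k i) (coordu k i.+1)
     - 4 * vertex_weight i * (coordu h i + coordC h) * (coordu k i + coordC k) /
       Num.sqrt (1 - (2 * (coordu X i + coordC X)) ^+ 2)).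

Lemma is_diff_Phi X : (0 < N)%N -> domain R N X ->
  is_diff X (Phi R N) (gradPhi X).
Proof.
move=> N0 /domainP dX.
rewrite (funext (fun Y => PhiE Y N0)).
apply: is_diff_sub; last by apply: is_diff_scale; exact: is_diff_coordC.
apply: is_diff_sumr => i.
have [u0 p01 S0] := dX i; have [v0 _ _] := dX i.+1.
have du := is_diff_coordu X i; have dv := is_diff_coordu X i.+1.
have dC := is_diff_coordC X.
exact: (is_diff_add (is_diff_triangle_term du dv u0 v0 S0)
  (is_diff_scale (vertex_weight i) (is_diff_potential_term dC du p01))).
Qed.

Lemma is_diff_gradPhi X h : domain R N X ->
  is_diff X (gradPhi^~ h) (hessPhi X h).
Proof.
move=> /domainP dX.
have -> : hessPhi X h = fun k => hessPhi X h k - 0.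
  by apply/funext => k; rewrite subr0.
rewrite /gradPhi; apply: is_diff_sub (is_diff_const _ _).
apply: is_diff_sumr => i.
have [u0 p01 S0] := dX i; have [v0 _ _] := dX i.+1.
have du := is_diff_coordu X i; have dv := is_diff_coordu X i.+1.
have dC := is_diff_coordC X.
have da := is_diff_triangle_alpha du dv u0 S0.
have S0' : 0 < heron (coordu X i.+1) (coordu X i) by rewrite heronC.
have db := is_diff_triangle_alpha dv du v0 S0'.
have dx := is_diff_acos_double (is_diff_add du dC) p01.
set x := fun y => acos _ in dx.
set a := fun y => triangle_alpha _ _ in da.
set b := fun y => triangle_alpha _ _ in db.
rewrite (_ : (fun y => _) = (fun y => (- 2 * coordu h i) * a y
   + (- 2 * coordu h i.+1) * b y
   + (vertex_weight i * 2 * (coordu h i + coordC h)) * x y)); last first.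
  by apply/funext => y; rewrite /a /b /x /triangle_beta /triangle_alpha; ring.
apply: is_diff_eq (is_diff_add (is_diff_add (is_diff_scale _ da)
  (is_diff_scale _ db)) (is_diff_scale _ dx)) _.
apply/funext => k; rewrite /edge_polar (heronC (coordu X i.+1)).
have r0 : 0 < Num.sqrt (heron (coordu X i) (coordu X i.+1)).
  by rewrite sqrtr_gt0.
have s0 : 0 < Num.sqrt (1 - (2 * (coordu X i + coordC X)) ^+ 2).
  by rewrite sqrtr_gt0; case/andP: p01 => ? ?; nra.
by field; rewrite !gt_eqF.
Qed.

End closed_polygon.

(** * Negativity of the Hessian *)

Section negativity.
Variables (R : realType) (N : nat).
Implicit Types (X h k : 'rV[R]_N.+1).

Lemma hessPhiC X h k : hessPhi X h k = hessPhi X k h.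
Proof.
by apply: eq_bigr => i _; rewrite edge_polarC; congr (_ - _ / _); ring.
Qed.

Lemma sum_cyclic (F : nat -> R) : (0 < N)%N -> F N = F 0%N ->
  \sum_(0 <= i < N) F i.+1 = \sum_(0 <= i < N) F i.
Proof.
move=> N0 FN; rewrite -(big_add1 _ _ 0%N N.+1 xpredT F).
rewrite [RHS]big_ltn// big_nat_recr//= FN addrC; congr (_ + _).
Qed.

(** The potential at a vertex has weight at least 1, so it pays for both adjacent
edges in [edge_negative].  A nonzero direction has a nonzero coordinate on some
edge, which makes that edge, hence the sum, strictly negative. *)
Lemma hessPhi_lt0 X h : (0 < N)%N -> domain R N X -> h != 0 ->
  hessPhi X h h < 0.
Proof.
move=> N0 /domainP dX h0.
pose s i := Num.sqrt (1 - (2 * (coordu X i + coordC X)) ^+ 2).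
pose b i := (coordu h i + coordC h) ^+ 2 / s i.
pose e i :=
  edge_hessian (coordu X i) (coordu X i.+1) (coordu h i) (coordu h i.+1).
have periodN (Y : 'rV[R]_N.+1) : coordu Y N = coordu Y 0%N.
  by rewrite /coordu modnn mod0n.
have b_ge0 i : 0 <= b i by rewrite divr_ge0 ?sqr_ge0 ?sqrtr_ge0.
have e_lt i : [|| coordC h != 0, coordu h i != 0 | coordu h i.+1 != 0] ->
    e i < 2 * b i + 2 * b i.+1.
  have [u0 p01 S0] := dX i; have [v0 q01 _] := dX i.+1; move=> nz.
  by apply: edge_negative => //; field.
have e_le i : e i <= 2 * b i + 2 * b i.+1.
  have [/e_lt/ltW//|] :=
    boolP [|| coordC h != 0, coordu h i != 0 | coordu h i.+1 != 0].
  rewrite !negb_or !negbK => /and3P[_ /eqP e1 /eqP e2].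
  rewrite /e /edge_hessian e1 e2 expr0n/= !mul0r addr0 !mulr0 subr0 mul0r.
  by rewrite addr_ge0// mulr_ge0.
have [j jnz] : exists j : 'I_N,
    [|| coordC h != 0, coordu h j != 0 | coordu h j.+1 != 0].
  have [c0|c0] := eqVneq (coordC h) 0; last by exists (Ordinal N0).
  have /rV0Pn[k hk] := h0.
  case: (unliftP ord0 k) hk => [j -> hj|->]; last first.
    by rewrite -/(coordC h) c0 eqxx.
  exists j; apply/or3P; apply: Or32.
  rewrite /coordu modn_small//.
  rewrite (_ : inord j.+1 = lift ord0 j)//; apply/val_inj.
  by rewrite /= inordK// ltnS.
have -> : hessPhi X h h = \sum_(0 <= i < N) (e i - 4 * vertex_weight R i * b i).
  apply: eq_bigr => i _; rewrite edge_polar_diag /b /s; congr (_ - _).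
  by rewrite expr2 !mulrA.
apply: (@le_lt_trans _ _ (\sum_(0 <= i < N) (e i - (2 * b i + 2 * b i.+1)))).
  rewrite !sumrB lerD2l lerN2 big_split /= -!mulr_sumr.
  rewrite sum_cyclic ?/b ?/s ?periodN// -mulrDl.
  rewrite mulr_sumr; apply: ler_sum => i _.
  by apply: ler_wpM2r; [exact: b_ge0 | have := vertex_weight_ge1 R i; lra].
rewrite big_mkord (bigD1 j)//= -[ltRHS]addr0; apply: ltr_leD.
  by rewrite subr_lt0 e_lt.
by apply: sumr_le0 => i _; rewrite subr_le0.
Qed.

Lemma Phi_second_order X : (0 < N)%N -> domain R N X ->
  twice_differentiable (Phi R N) X /\ negative_definite (hessian (Phi R N) X).
Proof.
move=> N0 dX.
have nearG : \forall Y \near X, is_diff Y (Phi R N) (gradPhi Y).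
  by apply: filterS (domain_near N0 dX) => Y dY; exact: is_diff_Phi.
have dG v : is_diff X (fun Y => gradPhi Y v) (hessPhi X v).
  exact: is_diff_gradPhi.
have [tw HE] := hessian_near nearG dG.
split=> //; split.
  apply/is_hermitianmxP; rewrite expr0 scale1r HE.
  by apply/matrixP => i j; rewrite !mxE /= hessPhiC.
move=> v v0.
rewrite -[ltLHS](is_diff_derive v (is_diff_derive_hessian v tw)).
have : is_diff X ('D_v (Phi R N)) (hessPhi X v).
  apply: near_eq_is_diff (dG v).
  by apply: filterS nearG => Y dY; rewrite (is_diff_derive _ dY).
by move=> /is_diff_derive ->; exact: hessPhi_lt0 N0 dX v0.
Qed.

End negativity.

Unset Implicit Arguments.
Set Strict Implicit.

Theorem theorem3 (R : realType) (N : nat) (N_ge7 : (7 <= N)%N)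
    (N_odd : odd N) :
  [/\ forall X : 'rV[R]_N.+1, domain R N X ->
        twice_differentiable (Phi R N) X /\
        negative_definite (hessian (Phi R N) X),
      convex_set (domain R N) &
      forall X Y : 'rV[R]_N.+1, domain R N X -> domain R N Y ->
        critical_point (Phi R N) X -> critical_point (Phi R N) Y -> X = Y].
Proof.
have N0 : (0 < N)%N by exact: leq_trans N_ge7.
split.
- by move=> X; exact: Phi_second_order.
- exact: domain_convex.
- move=> X Y dX dY; apply: (@critical_point_unique _ _ _ (domain R N)).
    by move=> Z /(Phi_second_order N0)[tw [_ neg]].
  move=> t /andP[t0 t1].
  have -> : X + t *: (Y - X) = t *: Y + (1 - t) *: X.
    by rewrite scalerBr scalerBl scale1r addrCA.
  by apply: domain_segment => //; apply/andP.
Qed.
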